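(* Let $A$ be a nonzero $m\times n$ matrix, let $1\leq k\leq \min(m,n)$, and suppose that $k$ Gaussian elimination (GE) steps are performed on $A$ with pivot qualities $0<\beta_1,\ldots,\beta_k\leq 1$. Then the intermediate growth factor $\rho_k(A)$ after $k$ GE steps on $A$ is bounded by \[ \rho_k(A) \leq 2\left(\beta_k+\beta_k^{-1}\right)\left(\beta_1^2\prod_{r=2}^{k-1}\beta_{r}^{\frac{1}{k-r}}\right)^{-1} \sqrt{k}\, k^{\frac{1}{4}\log k}. \]
   Context: Matrices have real or complex entries, $\log$ is the natural logarithm, and an empty product equals $1$ (so the product over $r$ is $1$ when $k\in\{1,2\}$). GE steps: set $A^{(0)}=A$. For $s=1,\ldots,k$, the $s$th GE step selects a nonzero entry $A^{(s-1)}_{i_s,j_s}$ of $A^{(s-1)}$ (the $s$th pivot; in particular $A^{(s-1)}\neq 0$) and defines \[ A^{(s)} = A^{(s-1)} - A^{(s-1)}_{:,j_s}\,A^{(s-1)}_{i_s,:}\Big/A^{(s-1)}_{i_s,j_s}, \] where $M_{:,j}$ and $M_{i,:}$ denote column $j$ (a column vector) and row $i$ (a row vector) of a matrix $M$. The pivot may be any nonzero entry; it need not be the entry of largest absolute value. Pivot quality: the quality of the $s$th pivot is \[ \beta_s = \left|A^{(s-1)}_{i_s,j_s}\right| \Big/ \max_{1\leq i\leq m}\max_{1\leq j\leq n}\left|A^{(s-1)}_{ij}\right| , \] so that $0<\beta_s\leq 1$, with $\beta_s=1$ exactly when the pivot is an entry of $A^{(s-1)}$ of maximum absolute value. Intermediate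 growth factor: for $1\le k\le \min(m,n)$, \[ \rho_k(A) = \max_{1\leq i\leq m}\max_{1\leq j\leq n} \left|A_{ij}^{(k)}\right| \Big/ \max_{1\leq i\leq m}\max_{1\leq j\leq n} \left|A_{ij}\right| \] (this depends on the chosen pivots). *)

(* Defs.v *)
From HB Require Import structures.
From mathcomp Require Import all_boot all_order all_algebra.
From mathcomp Require Import all_classical all_reals all_analysis.
From mathcomp Require Import complex.

Set Implicit Arguments.
Unset Strict Implicit.
Unset Printing Implicit Defensive.

Import Order.TTheory GRing.Theory Num.Theory.
Import numFieldNormedType.Exports.

Local Open Scope ring_scope.
Local Open Scope complex_scope.

(* Elimination is defined over an arbitrary field [K].  The absolute value
   [av : K -> R] is a parameter so that the growth factor and the pivot
   qualities are elements of the real field [R] both for [K = R] (where [av] is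
   [Num.norm]) and for [K = R[i]] (where the norm of MathComp is [R[i]]-valued,
   and [av] is the [R]-valued modulus [ComplexField.Normc.normc]). *)

(* The default value 0 of the maximum plays no role for a nonempty matrix,
   since the values of [av] are nonnegative. *)
Definition max_entry (R : realType) (K : fieldType) (av : K -> R) (m n : nat)
    (A : 'M[K]_(m, n)) : R :=
  \big[Num.max/0]_(i < m) \big[Num.max/0]_(j < n) av (A i j).

Definition ge_step (K : fieldType) (m n : nat) (A : 'M[K]_(m, n))
    (i : 'I_m) (j : 'I_n) : 'M[K]_(m, n) :=
  A - (A i j)^-1 *: (col j A *m row i A).

(* Steps are numbered from 1: the pivot of step [s] is at [(pr s, pc s)], and
   the values [pr 0], [pc 0] are never used. *)
Fixpoint ge_iter (K : fieldType) (m n : nat) (A : 'M[K]_(m, n))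
    (pr : nat -> 'I_m) (pc : nat -> 'I_n) (s : nat) : 'M[K]_(m, n) :=
  if s is s'.+1 then ge_step (ge_iter A pr pc s') (pr s) (pc s) else A.

Definition pivot (K : fieldType) (m n : nat) (A : 'M[K]_(m, n))
    (pr : nat -> 'I_m) (pc : nat -> 'I_n) (s : nat) : K :=
  ge_iter A pr pc s.-1 (pr s) (pc s).

Definition valid_pivots (K : fieldType) (m n : nat) (A : 'M[K]_(m, n))
    (pr : nat -> 'I_m) (pc : nat -> 'I_n) (k : nat) : Prop :=
  forall s : nat, (1 <= s <= k)%N -> pivot A pr pc s != 0.

Definition pivot_quality (R : realType) (K : fieldType) (av : K -> R)
    (m n : nat) (A : 'M[K]_(m, n)) (pr : nat -> 'I_m) (pc : nat -> 'I_n)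
    (s : nat) : R :=
  av (pivot A pr pc s) / max_entry av (ge_iter A pr pc s.-1).

Definition growth_factor (R : realType) (K : fieldType) (av : K -> R)
    (m n : nat) (A : 'M[K]_(m, n)) (pr : nat -> 'I_m) (pc : nat -> 'I_n)
    (k : nat) : R :=
  max_entry av (ge_iter A pr pc k) / max_entry av A.

(* Main.v *)
Require Import Defs.
From HB Require Import structures.
From mathcomp Require Import all_boot all_order all_algebra.
From mathcomp Require Import all_classical all_reals all_analysis.
From mathcomp Require Import complex.
From mathcomp Require Import ring lra zify.
Set Implicit Arguments.
Unset Strict Implicit.
Unset Printing Implicit Defensive.

Import Order.TTheory GRing.Theory Num.Theory.
Import numFieldNormedType.Exports.

Local Open Scope ring_scope.
Local Open Scope complex_scope.

(** Write M s for the largest modulus of an entry after s steps.  The argument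
    is Wilkinson's for complete pivoting, with the pivot qualities carried
    along.

    The submatrix of the r-times reduced matrix on the rows and columns of the
    pivots r+1, ..., k+1 has determinant the product of these pivots
    (det_pivots), since elimination is a sequence of Schur complements.  Its
    entries are at most M r, so Hadamard's inequality (hadamard_normc, obtained
    from the spectral theorem for A A^* and the arithmetic-geometric mean
    inequality) bounds the modulus of this product by (sqrt t * M r)^t with
    t = k+1-r.  The pivot of step r+1 has modulus beta_(r+1) M r; so, in
    logarithms, each tail sum of log-pivots is bounded in terms of its own
    first term.  Dividing by t shows that the averages of the tails grow with
    r by at most controlled amounts, and telescoping (averaged_recursion) yields
      M k / M 0 <= sqrt (k+1) * prod_(1 <= r <= k) beta_r^(-1/(k+1-r))
                   * prod_(2 <= s <= k+1) s^(1/(2(s-1)))           (ln_growth),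
    where the (k+1)st pivot is chosen to be an entry of modulus M k.

    The last product is k^(log k / 4) up to a bounded factor.  The excess of the
    logarithm of sqrt (k+1) times this product over that of
    sqrt k * k^(log k / 4) decreases for k >= 4 and is below log 2 at k = 4
    (wilkinson_excess_le), and beta_k^-1 <= beta_k + beta_k^-1, which settles
    k >= 4.  At k = 2 and 3 the excess is slightly above log 2.  For k <= 3 the
    bound is applied to the first k-1 steps instead, followed by the trivial
    estimate M k <= M (k-1) (1 + beta_k^-1) for the last one (ge_step_growth):
    the product is then at most (3/2) k^(log k / 4), and
    (3/2)(1 + beta^-1) <= 2 (beta + beta^-1) for every beta > 0.

    Everything is proved for complex matrices; a real matrix is embedded into
    the complex ones, which preserves elimination and moduli. *)

(** * Hadamard's inequality *)

Lemma normc_ge0 (R : realType) (z : R[i]) : 0 <= Normc.normc z.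
Proof. by case: z => a b; exact: sqrtr_ge0. Qed.

Lemma normc_gt0 (R : realType) (z : R[i]) : z != 0 -> 0 < Normc.normc z.
Proof.
move=> z0; rewrite lt_neqAle normc_ge0 andbT eq_sym.
by apply: contraNneq z0 => /Normc.eq0_normc ->.
Qed.

(** The spectral theorem makes [A *m A^*] diagonal with nonnegative entries:
    their product is [`|\det A| ^+ 2], their sum the squared Frobenius norm of
    [A], and the arithmetic-geometric mean inequality compares the two. *)
Lemma hadamard_mean (C : numClosedFieldType) n (A : 'M[C]_n) :
  `|\det A| ^+ 2 <= ((\sum_i \sum_j `|A i j| ^+ 2) / n%:R) ^+ n.
Proof.
pose B := A *m (map_mx Num.conj A^T).
have rowsq (M : 'M[C]_n) i :
    (M *m map_mx Num.conj M^T) i i = \sum_j `|M i j| ^+ 2.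
  by rewrite mxE; apply: eq_bigr => j _; rewrite !mxE normCK.
have normB : B \is normalmx.
  suff hB : map_mx Num.conj B^T = B by apply/normalmxP; rewrite hB.
  rewrite /B trmx_mul map_mxM map_trmx trmxK -map_mx_comp.
  by rewrite (map_mx_id (@conjCK _)).
set P := spectralmx B; set d := spectral_diag B.
have uP : P \is unitarymx by exact: spectral_unitarymx.
have unitP : P \in unitmx by exact: spectral_unit.
have defB : B = invmx P *m diag_mx d *m P by apply/orthomx_spectralP.
have diagE : (P *m A) *m map_mx Num.conj (P *m A)^T = diag_mx d.
  rewrite trmx_mul map_mxM mulmxA -[P *m A *m _]mulmxA -/B defB !mulmxA.
  by rewrite mulmxV // mul1mx mulmxtVK.
have d_ge0 i : 0 <= d 0 i.
  have := congr1 (fun M : 'M[C]_n => M i i) diagE.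
  rewrite /= rowsq mxE eqxx mulr1n => <-.
  by apply: sumr_ge0 => j _; rewrite exprn_ge0.
have detE : `|\det A| ^+ 2 = \prod_i d 0 i.
  have -> : `|\det A| ^+ 2 = \det B.
    by rewrite normCK det_mulmx det_map_mx det_tr.
  rewrite defB !det_mulmx det_inv det_diag mulrAC mulVf ?mul1r //.
  by rewrite -unitfE -unitmxE.
have trE : \sum_i \sum_j `|A i j| ^+ 2 = \sum_i d 0 i.
  rewrite -(eq_bigr _ (fun i _ => rowsq A i)) -/(mxtrace _) -/B defB -mulmxA.
  by rewrite mxtrace_mulC mulmxK // mxtrace_diag.
rewrite detE trE.
have := (@leif_AGM C _ predT (fun i => d 0 i) (fun i _ => d_ge0 i)).1.
by rewrite card_ord.
Qed.

(** The form of Hadamard's inequality suited to elimination, where all that is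
    known of the entries is a common bound. *)
Lemma hadamard_normc (R : realType) n (A : 'M[R[i]]_n) (M : R) :
  (forall i j, Normc.normc (A i j) <= M) ->
  Normc.normc (\det A) ^+ 2 <= (n%:R * M ^+ 2) ^+ n.
Proof.
move=> leM.
have normE (z : R[i]) : `|z| = (Normc.normc z)%:C by case: z.
rewrite -lecR rmorphXn /= -normE; apply: (le_trans (hadamard_mean A)).
case: n A leM => [|n] A leM; first by rewrite !expr0.
rewrite rmorphXn /= lerXn2r ?nnegrE ?divr_ge0 ?ler0n //.
- by do 2![apply: sumr_ge0 => ? _]; rewrite exprn_ge0.
- by rewrite lecR mulr_ge0 ?sqr_ge0 ?ler0n.
rewrite ler_pdivrMr ?ltr0n //.
have -> : (n.+1%:R * M ^+ 2)%:C * n.+1%:R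
    = \sum_(i < n.+1) \sum_(j < n.+1) ((M ^+ 2)%:C : R[i]).
  by rewrite !sumr_const card_ord rmorphM rmorph_nat mulr_natr mulr_natl.
apply: ler_sum => i _; apply: ler_sum => j _.
rewrite normE -rmorphXn lecR /= lerXn2r ?nnegrE ?normc_ge0 //.
exact: le_trans (normc_ge0 _) (leM i j).
Qed.

(** * Determinants and elimination *)

(** Clearing the first column by row operations leaves a block triangular matrix
    whose lower right block is the Schur complement of the corner. *)
Lemma det_schur (K : fieldType) t (S : 'M[K]_(1 + t)) :
  S 0 0 != 0 ->
  \det S = S 0 0 * \det (\matrix_(a < t, b < t)
     (S (rshift 1 a) (rshift 1 b)
      - (S 0 0)^-1 * (S (rshift 1 a) 0 * S 0 (rshift 1 b)))).
Proof.
move=> p_neq0; set T := (\matrix_(_, _) _).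
pose L := block_mx 1%:M 0 ((S 0 0)^-1 *: dlsubmx S) 1%:M : 'M[K]_(1 + t).
have l0 : lshift t (0 : 'I_1) = 0 by apply: val_inj.
suff defS : S = L *m block_mx (ulsubmx S) (ursubmx S) 0 T.
  rewrite {1}defS det_mulmx det_lblock !det1 !mul1r det_ublock det_mx11.
  by rewrite !mxE l0.
rewrite -[LHS]submxK mulmx_block !mul1mx !mul0mx !addr0.
congr block_mx; apply/matrixP => i j; rewrite !mxE ?big_ord1 ?mxE ?ord1 ?l0.
  by field.
by rewrite -mulrA subrKC.
Qed.

(** A step of elimination replaces the submatrix on the remaining pivot rows and
    columns by its Schur complement, so each step contributes its pivot to the
    determinant. *)
Lemma det_pivots (K : fieldType) m n (A : 'M[K]_(m, n)) pr pc t r :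
  (forall s, (r < s <= r + t)%N -> pivot A pr pc s != 0) ->
  \det (\matrix_(a < t, b < t)
          ge_iter A pr pc r (pr (r + a).+1) (pc (r + b).+1))
  = \prod_(a < t) pivot A pr pc (r + a).+1.
Proof.
elim: t r => [|t IH] r piv; first by rewrite det_mx00 big_ord0.
have piv0 : pivot A pr pc r.+1 != 0 by apply: piv; lia.
rewrite (@det_schur _ t) !mxE /= addn0 //.
rewrite big_ord_recl /= addn0; congr (_ * _).
have -> : \prod_(i < t) pivot A pr pc (r + bump 0 i).+1
        = \prod_(i < t) pivot A pr pc (r.+1 + i).+1.
  by apply: eq_bigr => i _; rewrite /bump addnA addn1.
rewrite -IH; last by move=> s hs; apply: piv; lia.
congr (\det _); apply/matrixP => a b; rewrite !mxE /= big_ord1 !mxE.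
by rewrite !addn0 !addnA !addn1.
Qed.

Lemma ge_iter_eq (K : fieldType) m n (A : 'M[K]_(m, n)) pr pc pr' pc' k :
  (forall s, (0 < s <= k)%N -> pr s = pr' s /\ pc s = pc' s) ->
  ge_iter A pr pc k = ge_iter A pr' pc' k.
Proof.
elim: k => [|k IH] eqp; first by [].
have [prE pcE] := eqp k.+1 (leqnn _).
rewrite /= prE pcE IH; first by [].
by move=> s /andP[s0 sk]; apply: eqp; rewrite s0 leqW.
Qed.

Lemma pivot_eq (K : fieldType) m n (A : 'M[K]_(m, n)) pr pc pr' pc' k :
  (forall s, (0 < s <= k.+1)%N -> pr s = pr' s /\ pc s = pc' s) ->
  pivot A pr pc k.+1 = pivot A pr' pc' k.+1.
Proof.
move=> eqp; have [prE pcE] := eqp k.+1 (leqnn _).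
rewrite /pivot prE pcE; congr (fun_of_matrix _ _ _); apply: ge_iter_eq.
by move=> s /andP[s0 sk]; apply: eqp; rewrite s0 leqW.
Qed.

Section MaxEntry.
Context (R : realType) (K : fieldType) (av : K -> R) (m n : nat).
Implicit Type A : 'M[K]_(m, n).

Lemma le_max_entry A i j : av (A i j) <= max_entry av A.
Proof.
apply: le_trans (le_bigmax 0 (fun i => \big[Num.max/0]_(j < n) av (A i j)) i).
exact: (le_bigmax 0 (fun j => av (A i j)) j).
Qed.

Lemma max_entry_le A (M : R) :
  0 <= M -> (forall i j, av (A i j) <= M) -> max_entry av A <= M.
Proof. by move=> M0 leM; do 2![apply: bigmax_le => // ? _]. Qed.

Lemma max_entry_attained A :
  0 < max_entry av A -> exists i j, av (A i j) = max_entry av A.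
Proof.
move=> M_gt0; apply/not_existsP => noi.
suff : max_entry av A < max_entry av A by rewrite ltxx.
do 2![apply: bigmax_lt => // ? _].
rewrite lt_neqAle le_max_entry andbT; apply/eqP => eqM.
by apply: (noi _); eexists; exact: eqM.
Qed.
End MaxEntry.

(** * The averaged recursion and Wilkinson's function *)

(** The Pade bound is tangent to [ln] to second order at 1: the difference has
    derivative [(t - 1) ^+ 2 / (t * (t + 1) ^+ 2)]. *)
Lemma ln_ge_pade (R : realType) (y : R) :
  1 <= y -> 2 * (y - 1) / (y + 1) <= ln y.
Proof.
move=> y1.
pose f (t : R) := ln t + 4 * (t + 1)^-1.
have df (t : R) : 1 <= t -> is_derive t 1 f (t^-1 - 4 / (t + 1) ^+ 2).
  move=> t1.
  have t0 : 0 < t by lra.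
  have t10 : t + 1 != 0 by apply: lt0r_neq0; lra.
  have dV : is_derive t 1 (fun u : R => (u + 1)^-1) (- (t + 1) ^- 2 *: 1).
    by apply: is_deriveV => //; apply: is_derive_shift.
  apply: (is_derive_eq (is_deriveD (is_derive1_ln t0) (is_deriveZ 4 dV))).
  by rewrite /GRing.scale /=; field; rewrite t10 lt0r_neq0.
have dfoo t : t \in `]1, y[ -> is_derive t 1 f (t^-1 - 4 / (t + 1) ^+ 2).
  by rewrite in_itv /= => /andP[/ltW/df].
have [|c] := MVT_segment y1 dfoo.
  apply: derivable_within_continuous => t; rewrite in_itv /= => /andP[t1 _].
  by have [] := df t t1.
rewrite in_itv /= => /andP[c1 _]; rewrite /f ln1 => eqf.
have : 0 <= (c^-1 - 4 / (c + 1) ^+ 2) * (y - 1).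
  rewrite mulr_ge0 ?subr_ge0 //.
  have c0 : 0 < c by lra.
  rewrite -subr_ge0 (_ : _ - _ = (c - 1) ^+ 2 / (c * (c + 1) ^+ 2)).
    by rewrite divr_ge0 ?sqr_ge0 // mulr_ge0 ?sqr_ge0 // ltW.
  by field; rewrite !lt0r_neq0 //; lra.
rewrite -eqf (_ : 2 * (y - 1) / (y + 1) = 2 - 4 * (y + 1)^-1); last first.
  by field; rewrite lt0r_neq0 //; lra.
have -> : 4 * (1 + 1)^-1 = 2 :> R by field.
lra.
Qed.

(** The logarithm of the product of the [s^(1/(2(s-1)))] for [2 <= s <= k+1],
    the main factor of Wilkinson's bound after [k] steps. *)
Definition ln_wilkinson (R : realType) (k : nat) : R :=
  \sum_(0 <= r < k) ln r.+2%:R / (2 * r.+1%:R).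

(** Let [S] be the sum of [x] over the tail starting at [r+1] and [N = k - r]
    its length.  Since the tail from [r] is [x r + S], the hypothesis at [r]
    is equivalent to
      S / N <= (x r + S) / (N + 1) + (mu r - x r) / N + ln (N + 1) / (2 N),
    so the averages of the tails can be telescoped, from the average of all the
    terms (bounded by the hypothesis at 0) to the last term alone. *)
Lemma averaged_recursion (R : realType) (k : nat) (x mu : nat -> R) :
  (forall r, (r <= k)%N -> \sum_(r <= s < k.+1) x s
     <= (k.+1 - r)%:R * (mu r + ln (k.+1 - r)%:R / 2)) ->
  x k <= mu 0%N + ln k.+1%:R / 2
         + \sum_(0 <= r < k) (mu r - x r) / (k - r)%:R + ln_wilkinson R k.
Proof.
move=> hyp.
have -> : ln_wilkinson R k
    = \sum_(0 <= r < k) ln (k.+1 - r)%:R / (2 * (k - r)%:R).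
  rewrite /ln_wilkinson big_nat_rev /= [LHS]big_nat [RHS]big_nat.
  apply: eq_bigr => r /andP[_ hr].
  by rewrite add0n -subSn // subSS -subSn 1?ltnW.
suff avg j : (j <= k)%N ->
    (\sum_(j <= s < k.+1) x s) / (k.+1 - j)%:R
    <= mu 0%N + ln k.+1%:R / 2 + \sum_(0 <= r < j) (mu r - x r) / (k - r)%:R
       + \sum_(0 <= r < j) ln (k.+1 - r)%:R / (2 * (k - r)%:R).
  by have := avg k (leqnn k); rewrite big_nat1 subSnn divr1.
elim: j => [|j IH] ltjk.
  rewrite !(@big_geq _ _ _ 0 0) // !addr0 subn0 ler_pdivrMr ?ltr0n // mulrC.
  by have := hyp 0%N isT; rewrite subn0.
have := IH (ltnW ltjk); have := hyp j (ltnW ltjk).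
rewrite !(@big_nat_recr _ _ _ j) //= (@big_ltn _ _ _ j) ?ltnS 1?ltnW // subSS.
set S := (\sum_(j.+1 <= s < k.+1) x s).
have -> : (k.+1 - j)%:R = (k - j)%:R + 1 :> R by rewrite subSn 1?ltnW // -natr1.
have : 0 < (k - j)%:R :> R by rewrite ltr0n subn_gt0.
move: (k - j)%:R => N N0 hS hT.
set B := \sum_(_ <= _ < _) _ in hT *; set D := \sum_(_ <= _ < _) _ in hT *.
suff : S / N <= (x j + S) / (N + 1) + (mu j - x j) / N + ln (N + 1) / (2 * N).
  by move: hT; set T := _ / (N + 1); set c := _ / N; set c' := ln _ / _; lra.
have N1 : 0 < N + 1 by lra.
rewrite -subr_ge0.
have -> : (x j + S) / (N + 1) + (mu j - x j) / N + ln (N + 1) / (2 * N) - S / N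
  = ((N + 1) * (mu j + ln (N + 1) / 2) - (x j + S)) / (N * (N + 1)).
  by field; rewrite !gt_eqF.
by rewrite divr_ge0 ?subr_ge0 // mulr_ge0 // ltW.
Qed.


(** The bound has to be nearly this sharp: [wilkinson_excess_le] holds at
    [k = 4] by a margin of less than one percent. *)
Lemma ln2_ge (R : realType) : 689 / 1000 <= ln 2 :> R.
Proof.
(* A telescoping product of ratios close to 1, where the Pade bound is sharp. *)
have -> : ln 2 = ln (6 / 5) + ln (5 / 4) + ln (4 / 3) :> R.
  by rewrite -!lnM ?posrE ?mulr_gt0 //; congr ln; field.
have h1 := @ln_ge_pade R (6 / 5) ltac:(lra).
have h2 := @ln_ge_pade R (5 / 4) ltac:(lra).
have h3 := @ln_ge_pade R (4 / 3) ltac:(lra).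
have e1 : 2 * (6 / 5 - 1) / (6 / 5 + 1) = 2 / 11 :> R by field.
have e2 : 2 * (5 / 4 - 1) / (5 / 4 + 1) = 2 / 9 :> R by field.
have e3 : 2 * (4 / 3 - 1) / (4 / 3 + 1) = 2 / 7 :> R by field.
rewrite e1 in h1; rewrite e2 in h2; rewrite e3 in h3.
lra.
Qed.

(** The logarithm of the factor by which Wilkinson's bound after [k] steps
    exceeds [Num.sqrt k * k `^ (ln k / 4)]. *)
Definition wilkinson_excess (R : realType) (k : nat) : R :=
  ln k.+1%:R / 2 + ln_wilkinson R k - ln k%:R / 2 - ln k%:R ^+ 2 / 4.

(** With [K = k + 1] and [x = 1 / K], four times the increment is
      - 2 (u - v) + 2 v x - 2 (u - x) ln K + u^2,
    where [u = ln K - ln (K - 1)] and [v = ln (K + 1) - ln K].  Here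
    [u - v >= x^2] and [v <= x] make the first two terms cancel; as
    [u - x >= x^2 / 2], what is left is at most [u^2 - x^2 ln K], and this is
    nonpositive because [u <= 5/4 x] and [ln K >= (5/4)^2] when [K >= 5]. *)
Lemma wilkinson_excess_step (R : realType) k :
  (4 <= k)%N -> wilkinson_excess R k.+1 <= wilkinson_excess R k.
Proof.
move=> k4; rewrite /wilkinson_excess /ln_wilkinson big_nat_recr //=.
set W := \sum_(_ <= _ < _) _.
pose K : R := k.+1%:R.
have -> : k.+2%:R = K + 1 :> R by rewrite natr1.
have -> : k%:R = K - 1 :> R by rewrite /K -natr1 addrK.
rewrite -/K.
have K5 : 5 <= K by rewrite (ler_nat _ 5).
move: K K5 => K K5.
have K0 : 0 < K by lra.
have Kn0 : K != 0 by rewrite lt0r_neq0.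
pose x := K^-1.
have x0 : 0 < x by rewrite invr_gt0.
have xK : x * K = 1 by rewrite mulVf.
have lnDK y : -1 < y -> ln (K * (1 + y)) <= ln K + y.
  by move=> y1; rewrite lnM ?posrE //; [rewrite lerD2l le_ln1Dx | lra].
have v_le : ln (K + 1) <= ln K + x.
  have -> : K + 1 = K * (1 + x) by rewrite mulrDr mulr1 mulrC xK.
  by apply: lnDK; lra.
have gap : ln (K - 1) + ln (K + 1) <= 2 * ln K - x ^+ 2.
  rewrite -lnM ?posrE; [|lra|lra].
  have -> : (K - 1) * (K + 1) = K ^+ 2 * (1 + - x ^+ 2) by rewrite /x; field.
  have x1 : x < 1 by rewrite /x invf_lt1 //; lra.
  have x2 : x ^+ 2 < 1 by rewrite expr_lt1 // ltW.
  rewrite lnM ?posrE ?exprn_gt0 //; last lra.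
  rewrite lnXn // mulr2n.
  have := @le_ln1Dx _ (- x ^+ 2) ltac:(lra); lra.
have K1 : 0 < K - 1 by lra.
have uE : ln (K / (K - 1)) = ln K - ln (K - 1) by rewrite ln_div.
have u_ge : x + x ^+ 2 / 2 <= ln K - ln (K - 1).
  rewrite -uE; apply: le_trans (ln_ge_pade _).
    have -> : 2 * (K / (K - 1) - 1) / (K / (K - 1) + 1) = 2 / (2 * K - 1).
      by field; rewrite !lt0r_neq0 //; lra.
    rewrite ler_pdivlMr; last lra.
    rewrite (_ : (x + x ^+ 2 / 2) * (2 * K - 1) = 2 - x ^+ 2 / 2); last first.
      by rewrite /x; field.
    by have := sqr_ge0 x; lra.
  by rewrite ler_pdivlMr //; lra.
have u_le : ln K - ln (K - 1) <= 5 / 4 * x.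
  have -> : ln K = ln ((K - 1) * (1 + (K - 1)^-1)).
    by congr ln; field; rewrite lt0r_neq0.
  have i0 : 0 < (K - 1)^-1 by rewrite invr_gt0.
  rewrite lnM ?posrE //; last lra.
  have := @le_ln1Dx _ ((K - 1)^-1) ltac:(lra).
  suff : (K - 1)^-1 <= 5 / 4 * x by lra.
  rewrite -(ler_pM2r K1) mulVf ?lt0r_neq0 //.
  have -> : 5 / 4 * x * (K - 1) = 5 / 4 - 5 / 4 * x by rewrite /x; field.
  suff : x <= 5^-1 by lra.
  by rewrite lef_pV2 ?posrE.
have L_ge : 25 / 16 <= ln K.
  have : ln 5 <= ln K by rewrite ler_ln ?posrE.
  have -> : ln 5 = ln 2 + ln 2 + ln (5 / 4) :> R.
    by rewrite -!lnM ?posrE ?mulr_gt0 //; congr ln; field.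
  have := ln2_ge R; have := @ln_ge_pade R (5 / 4) ltac:(lra).
  have -> : 2 * (5 / 4 - 1) / (5 / 4 + 1) = 2 / 9 :> R by field.
  lra.
have -> : ln (K + 1) / (2 * K) = ln (K + 1) * x / 2 by rewrite /x; field.
move: (ln K) (ln (K + 1)) (ln (K - 1)) v_le gap u_ge u_le L_ge.
move=> L a b v_le gap u_ge u_le L_ge; clear -x0 v_le gap u_ge u_le L_ge.
have u2 : (L - b) ^+ 2 <= L * x ^+ 2.
  apply: le_trans (_ : (5 / 4 * x) ^+ 2 <= _).
    by rewrite lerXn2r ?nnegrE //; nra.
  by rewrite exprMn ler_wpM2r ?sqr_ge0 //; lra.
have h1 : 0 <= L * (L - b - (x + x ^+ 2 / 2)) by rewrite mulr_ge0 //; lra.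
have h2 : 0 <= x * (L + x - a) by rewrite mulr_ge0 //; lra.
nra.
Qed.

Lemma wilkinson_excess_le (R : realType) k :
  (4 <= k)%N -> wilkinson_excess R k <= ln 2.
Proof.
elim: k => // k IH; rewrite leq_eqVlt => /predU1P[<-|k4]; last first.
  exact: le_trans (wilkinson_excess_step _ k4) (IH k4).
rewrite /wilkinson_excess /ln_wilkinson !big_nat_recr //= big_geq // add0r.
have ln4 : ln 4 = 2 * ln 2 :> R.
  by rewrite (_ : 4 = 2 ^+ 2) ?lnXn ?mulr_natl // -natrX.
(* 5^3 <= 2^7 and 3^17 <= 2^27 reduce the case k = 4 to a bound on ln 2. *)
have ln5 : 3 * ln 5 <= 7 * ln 2 :> R.
  rewrite !mulr_natl -!lnXn // ler_ln ?posrE ?exprn_gt0 //; lra.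
have ln3 : 17 * ln 3 <= 27 * ln 2 :> R.
  rewrite !mulr_natl -!lnXn // ler_ln ?posrE ?exprn_gt0 //; lra.
have := ln2_ge R; rewrite ln4.
move: (ln 2 : R) ln3 ln5 => l ln3 ln5 l_ge.
have l2_ge : 689 / 1000 * l <= l ^+ 2 by rewrite expr2 ler_wpM2r //; lra.
rewrite [leLHS](_ : _ = 5 / 8 * ln 5 + ln 3 / 4 - l / 6 - l ^+ 2).
  lra.
by field.
Qed.

(** In the product, the factor [2^(1/2)] is at most 3/2, and the factor
    [3^(1/4)] at most [3^(ln 3 / 4)] because [ln 3 >= 1]. *)
Lemma ln_wilkinson_small (R : realType) k : (k <= 2)%N ->
  ln_wilkinson R k <= ln (3 / 2) + ln k.+1%:R ^+ 2 / 4.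
Proof.
have l2 := ln2_ge R.
have l32 := @ln_ge_pade R (3 / 2) ltac:(lra).
have e32 : 2 * (3 / 2 - 1) / (3 / 2 + 1) = 2 / 5 :> R by field.
rewrite e32 in l32.
have ln3 : ln 3 = ln (3 / 2) + ln 2 :> R.
  by rewrite -lnM ?posrE ?divr_gt0 //; congr ln; field.
have ln2 : ln 2 <= 2 * ln (3 / 2) :> R.
  rewrite mulr_natl -lnXn ?divr_gt0 //.
  rewrite ler_ln ?posrE ?exprn_gt0 ?divr_gt0 //; lra.
rewrite /ln_wilkinson; case: k => [|[|[|//]]] _.
- by rewrite big_geq // ln1; lra.
- rewrite big_nat1 [leLHS](_ : _ = ln 2 / 2); last by field.
  by have := sqr_ge0 (ln 2 : R); lra.
have ln3_sqr : ln 3 <= ln 3 ^+ 2 :> R by rewrite expr2 ler_peMl //; lra.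
rewrite big_nat_recr //= big_nat1 [leLHS](_ : _ = ln 2 / 2 + ln 3 / 4).
  lra.
by field.
Qed.

(** * Growth bounds for complex matrices *)

Lemma prod_expR_ln (R : realType) (I : Type) (s : seq I) (P : pred I)
    (F : I -> R) :
  (forall i, P i -> 0 < F i) ->
  \prod_(i <- s | P i) F i = expR (\sum_(i <- s | P i) ln (F i)).
Proof.
by move=> F0; rewrite expR_sum; apply: eq_bigr => i /F0 Fi; rewrite lnK ?posrE.
Qed.

Section ComplexGrowth.
Context (R : realType) (m n : nat).
Local Notation nm := (@Normc.normc R).
Implicit Types (A : 'M[R[i]]_(m, n)) (pr : nat -> 'I_m) (pc : nat -> 'I_n).

(** Hadamard's inequality turns the determinant of the next [t] pivot rows and
    columns into the hypothesis of [averaged_recursion] at [r]. *)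
Lemma pivots_hadamard A pr pc r t :
  (forall s, (r < s <= r + t)%N -> pivot A pr pc s != 0) ->
  0 < max_entry nm (ge_iter A pr pc r) ->
  \sum_(a < t) ln (nm (pivot A pr pc (r + a).+1))
    <= t%:R * (ln (max_entry nm (ge_iter A pr pc r)) + ln t%:R / 2).
Proof.
case: t => [|t] piv M_gt0; first by rewrite big_ord0 mul0r.
set M := max_entry _ _ in M_gt0 *; set S := \sum_(_ < _) _.
have p_gt0 (a : 'I_t.+1) : 0 < nm (pivot A pr pc (r + a).+1).
  by apply/normc_gt0/piv; have := ltn_ord a; lia.
have := @hadamard_normc R _ (\matrix_(a < t.+1, b < t.+1)
  ge_iter A pr pc r (pr (r + a).+1) (pc (r + b).+1)) M.
rewrite det_pivots // (big_morph _ (@Normc.normcM R) (@Normc.normc1 R)).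
rewrite prod_expR_ln // -/S => /(_ _)/wrap[|had].
  by move=> a b; rewrite mxE le_max_entry.
have tM : 0 < t.+1%:R * M ^+ 2 by rewrite mulr_gt0 ?exprn_gt0.
move: had; rewrite -expRM_natl -ler_ln ?posrE ?expR_gt0 ?exprn_gt0 //.
rewrite expRK lnXn //.
rewrite lnM ?posrE ?exprn_gt0 // lnXn // -[leRHS]mulr_natl.
set l := ln t.+1%:R; set c := ln M; set N := t.+1%:R; lra.
Qed.

Lemma pivot_le_max A pr pc s :
  nm (pivot A pr pc s.+1) <= max_entry nm (ge_iter A pr pc s).
Proof. exact: le_max_entry. Qed.

(** Wilkinson's bound.  The first [k] pivots are prolonged by a pivot of step
    [k+1] at an entry of maximal modulus, so that the growth after [k] steps is
    itself measured by a pivot. *)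
Lemma ln_growth A pr pc k :
  valid_pivots A pr pc k -> 0 < max_entry nm (ge_iter A pr pc k) ->
  ln (max_entry nm (ge_iter A pr pc k)) <=
    ln (max_entry nm A) + ln k.+1%:R / 2
    + \sum_(1 <= r < k.+1) - ln (pivot_quality nm A pr pc r) / (k.+1 - r)%:R
    + ln_wilkinson R k.
Proof.
move=> piv Mk_gt0.
have [i [j maxE]] := max_entry_attained Mk_gt0.
pose pr' s := if s == k.+1 then i else pr s.
pose pc' s := if s == k.+1 then j else pc s.
have eqp s : (s <= k)%N -> pr' s = pr s /\ pc' s = pc s.
  by move=> sk; rewrite /pr' /pc' ltn_eqF.
have iterE s : (s <= k)%N -> ge_iter A pr' pc' s = ge_iter A pr pc s.
  move=> sk; apply: ge_iter_eq => u /andP[_ us].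
  exact: eqp (leq_trans us sk).
have pivE s : (s < k)%N -> pivot A pr' pc' s.+1 = pivot A pr pc s.+1.
  move=> sk; apply: pivot_eq => u /andP[_ us].
  exact: eqp (leq_trans us sk).
have pivk : nm (pivot A pr' pc' k.+1) = max_entry nm (ge_iter A pr pc k).
  by rewrite -maxE -iterE /pivot /pr' /pc' ?eqxx.
have piv' s : (s <= k)%N -> pivot A pr' pc' s.+1 != 0.
  rewrite leq_eqVlt => /predU1P[->|sk]; last by rewrite pivE // piv; lia.
  by apply: contraTneq Mk_gt0 => p0; rewrite -pivk p0 Normc.normc0 ltxx.
have M_gt0 s : (s <= k)%N -> 0 < max_entry nm (ge_iter A pr pc s).
  move=> sk; rewrite -iterE //.
  exact: lt_le_trans (normc_gt0 (piv' s sk)) (pivot_le_max _ _ _ _).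
have := @averaged_recursion R k (fun s => ln (nm (pivot A pr' pc' s.+1)))
  (fun s => ln (max_entry nm (ge_iter A pr pc s))) _.
rewrite pivk big_add1 /= => /(_ _)/wrap[|].
  move=> r rk; rewrite -{1}[r]add0n big_addn big_mkord -iterE //.
  under eq_bigr do rewrite addnC.
  apply: pivots_hadamard; last by rewrite iterE // M_gt0.
  by case=> // s hs; apply: piv'; lia.
suff -> : \sum_(0 <= r < k)
      - ln (pivot_quality nm A pr pc r.+1) / (k.+1 - r.+1)%:R
  = \sum_(0 <= r < k) (ln (max_entry nm (ge_iter A pr pc r))
      - ln (nm (pivot A pr' pc' r.+1))) / (k - r)%:R by [].
rewrite [LHS]big_nat [RHS]big_nat; apply: eq_bigr => r /andP[_ rk].
rewrite subSS pivE // /pivot_quality /= ln_div ?posrE ?opprB //.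
- by apply/normc_gt0/piv; lia.
- by apply: M_gt0; lia.
Qed.

(** An entry changes by a product of two entries over the pivot, that is by at
    most the maximum divided by the quality of the pivot. *)
Lemma ge_step_growth A i j : A i j != 0 ->
  max_entry nm (ge_step A i j) <=
    max_entry nm A * (1 + (nm (A i j) / max_entry nm A)^-1).
Proof.
move=> p0; have p_gt0 := normc_gt0 p0.
have M_gt0 : 0 < max_entry nm A := lt_le_trans p_gt0 (le_max_entry _ _ _ _).
have leM a b : nm (A a b) <= max_entry nm A by exact: le_max_entry.
set M := max_entry nm A in M_gt0 leM *; set p := nm (A i j) in p_gt0 *.
have -> : M * (1 + (p / M)^-1) = M + p^-1 * (M * M).
  by field; rewrite !lt0r_neq0.
have pV_ge0 : 0 <= p^-1 by rewrite invr_ge0 ltW.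
apply: max_entry_le => [|a b].
  by rewrite addr_ge0 ?mulr_ge0 // ltW.
rewrite !mxE big_ord1 !mxE; apply: le_trans (le_normcD _ _) _.
rewrite normcN lerD // !Normc.normcM Normc.normcV.
by rewrite ler_wpM2l // ler_pM ?normc_ge0.
Qed.
End ComplexGrowth.

(** The passage from the two available bounds on the log-growth [y] to the
    stated one: the first serves for [k >= 4], the second for [k <= 3].
    Weakening the exponents [1 / (k + 1 - r)] to [1 / (k - r)], and that of the
    first quality to 2, is allowed since the [b r] are nonnegative. *)
Lemma log_growth_combine (R : realType) k (b : nat -> R) (beta y : R) :
  (0 < k)%N -> 0 < beta -> b k = - ln beta ->
  (forall r, (1 <= r <= k)%N -> 0 <= b r) ->
  y <= ln k.+1%:R / 2 + \sum_(1 <= r < k.+1) b r / (k.+1 - r)%:R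
       + ln_wilkinson R k ->
  y <= ln (1 + beta^-1) + (ln k%:R / 2 + \sum_(1 <= r < k) b r / (k - r)%:R
       + ln_wilkinson R k.-1) ->
  y <= ln 2 + ln (beta + beta^-1)
       + (2 * b 1%N + \sum_(2 <= r < k) b r / (k - r)%:R)
       + ln k%:R / 2 + ln k%:R ^+ 2 / 4.
Proof.
move=> k_gt0 beta_gt0 bk b_ge0 hA hB.
have b1_ge0 : 0 <= b 1%N by apply: b_ge0.
have betaV_gt0 : 0 < beta^-1 by rewrite invr_gt0.
have first_term d : (0 < d)%N -> b 1%N / d%:R <= 2 * b 1%N.
  move=> d_gt0; rewrite ler_pdivrMr ?ltr0n //.
  have : 1 <= d%:R :> R by rewrite ler1n.
  by move: (d%:R) => D D1; nra.
have [k3|k4] := leqP k 3.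
  have sum_le : \sum_(1 <= r < k) b r / (k - r)%:R
      <= 2 * b 1%N + \sum_(2 <= r < k) b r / (k - r)%:R.
    have [k1|k1] := leqP k 1.
      by rewrite !big_geq ?addr0 ?mulr_ge0 // ltnW.
    by rewrite big_ltn // lerD2r first_term // subn_gt0.
  have wilk : ln_wilkinson R k.-1 <= ln (3 / 2) + ln k%:R ^+ 2 / 4.
    by rewrite -[X in ln X%:R](prednK k_gt0) ln_wilkinson_small //; lia.
  suff : ln (3 / 2) + ln (1 + beta^-1) <= ln 2 + ln (beta + beta^-1) by lra.
  rewrite -!lnM ?posrE ?divr_gt0 ?addr_gt0 //.
  rewrite ler_ln ?posrE ?mulr_gt0 ?divr_gt0 ?addr_gt0 //.
  rewrite -(ler_pM2r beta_gt0).
  have -> : 3 / 2 * (1 + beta^-1) * beta = 3 / 2 * (beta + 1).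
    by field; rewrite lt0r_neq0.
  have -> : 2 * (beta + beta^-1) * beta = 2 * (beta ^+ 2 + 1).
    by field; rewrite lt0r_neq0.
  (* 2 beta^2 - 3/2 beta + 1/2 is positive, with its minimum at 3/8. *)
  by have := sqr_ge0 (beta - 3 / 8); nra.
have excess := wilkinson_excess_le R k4; rewrite /wilkinson_excess in excess.
have last_term : b k <= ln (beta + beta^-1).
  by rewrite bk -lnV ?posrE // ler_ln ?posrE ?addr_gt0 // lerDr ltW.
have sum_le : \sum_(1 <= r < k.+1) b r / (k.+1 - r)%:R
    <= 2 * b 1%N + \sum_(2 <= r < k) b r / (k - r)%:R + b k.
  rewrite big_nat_recr //= subSnn divr1 lerD2r big_ltn; last lia.
  rewrite lerD ?first_term // ?subn_gt0 //.
  rewrite big_nat [leRHS]big_nat; apply: ler_sum => r /andP[r2 rk].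
  rewrite ler_wpM2l ?b_ge0 ?(ltnW r2) ?(ltnW rk) //.
  by rewrite lef_pV2 ?posrE ?ltr0n ?ler_nat ?subn_gt0 ?leq_sub2r // ltnW.
lra.
Qed.

Lemma growth_factor_complex (R : realType) (m n k : nat) (A : 'M[R[i]]_(m, n))
    (pr : nat -> 'I_m) (pc : nat -> 'I_n)
    (beta := pivot_quality (@Normc.normc R) A pr pc) :
  (0 < k)%N -> valid_pivots A pr pc k ->
  growth_factor (@Normc.normc R) A pr pc k <=
    2 * (beta k + (beta k)^-1)
    * (beta 1%N ^+ 2 * \prod_(2 <= r < k) (beta r `^ ((k - r)%:R^-1)))^-1
    * Num.sqrt k%:R * (k%:R `^ (4^-1 * ln k%:R)).
Proof.
move=> k_gt0 piv; rewrite /growth_factor.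
pose M s := max_entry (@Normc.normc R) (ge_iter A pr pc s).
have p_gt0 s : (1 <= s <= k)%N -> 0 < Normc.normc (pivot A pr pc s).
  by move=> hs; apply: normc_gt0 (piv s hs).
have p_le s : (0 < s)%N -> Normc.normc (pivot A pr pc s) <= M s.-1.
  by case: s => // s _; exact: pivot_le_max.
have M_gt0 s : (s < k)%N -> 0 < M s.
  by move=> sk; apply: lt_le_trans (p_gt0 s.+1 sk) (p_le s.+1 isT).
have beta_gt0 s : (1 <= s <= k)%N -> 0 < beta s.
  move=> /andP[s0 sk]; rewrite divr_gt0 ?p_gt0 ?s0 //.
  by apply: M_gt0; rewrite prednK.
have beta_le1 s : (1 <= s <= k)%N -> beta s <= 1.
  move=> /andP[s0 sk]; rewrite ler_pdivrMr ?mul1r ?p_le //.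
  by apply: M_gt0; rewrite prednK.
have k0 : 0 < k%:R :> R by rewrite ltr0n.
have beta1_gt0 : 0 < beta 1%N by apply: beta_gt0; rewrite leqnn.
have betak_gt0 : 0 < beta k by apply: beta_gt0; rewrite k_gt0 leqnn.
have middle r : (2 <= r < k)%N -> 0 < beta r.
  by move=> /andP[r2 rk]; apply: beta_gt0; rewrite (ltnW r2) ltnW.
set P := \prod_(_ <= _ < _) _.
have PE : P = expR (- \sum_(2 <= r < k) - ln (beta r) / (k - r)%:R).
  rewrite /P -sumrN expR_sum [LHS]big_nat [RHS]big_nat.
  apply: eq_bigr => r hr; rewrite /powR gt_eqF ?middle //.
  by congr expR; rewrite mulNr opprK mulrC.
have P_gt0 : 0 < P by rewrite PE expR_gt0.
have sum_gt0 : 0 < beta k + (beta k)^-1 by rewrite addr_gt0 ?invr_gt0.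
have den_gt0 : 0 < beta 1%N ^+ 2 * P by rewrite mulr_gt0 ?exprn_gt0.
set rhs := (X in _ <= X).
have rhs_gt0 : 0 < rhs.
  by rewrite !mulr_gt0 ?invr_gt0 ?sqrtr_gt0 ?powR_gt0.
have ln_rhs : ln rhs = ln 2 + ln (beta k + (beta k)^-1)
    + (2 * - ln (beta 1%N) + \sum_(2 <= r < k) - ln (beta r) / (k - r)%:R)
    + ln k%:R / 2 + ln k%:R ^+ 2 / 4.
  rewrite /rhs lnM ?posrE ?mulr_gt0 ?invr_gt0 ?sqrtr_gt0 ?powR_gt0 //.
  rewrite lnM ?posrE ?mulr_gt0 ?invr_gt0 ?sqrtr_gt0 //.
  rewrite lnM ?posrE ?mulr_gt0 ?invr_gt0 // lnM ?posrE //.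
  rewrite lnV ?posrE // lnM ?posrE ?exprn_gt0 // lnXn // PE expRK.
  by rewrite -powR12_sqrt ?ln_powR ?ltW //; field.
(* When elimination ends with the zero matrix, ln (M k) does not measure M k. *)
have [Mk0|Mk_gt0] := leP (M k) 0.
  apply: le_trans (ltW rhs_gt0).
  by rewrite mulr_le0_ge0 // invr_ge0 ltW // (M_gt0 0%N).
have M0_gt0 : 0 < max_entry (@Normc.normc R) A := M_gt0 0%N k_gt0.
rewrite -ler_ln ?posrE ?divr_gt0 // ln_div ?posrE // ln_rhs.
apply: (@log_growth_combine R k (fun r => - ln (beta r))) => //.
- by move=> r hr; rewrite oppr_ge0 ln_le0 // beta_le1.
- by have := ln_growth piv Mk_gt0; rewrite -/beta; lra.
have Mk'_gt0 : 0 < M k.-1 by apply: M_gt0; rewrite prednK.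
have pivk' : valid_pivots A pr pc k.-1.
  by move=> s /andP[s0 sk]; apply: piv; rewrite s0 (leq_trans sk) // leq_pred.
have := ln_growth pivk' Mk'_gt0; rewrite prednK // -/beta => prev.
have step : M k <= M k.-1 * (1 + (beta k)^-1).
  have := piv k; rewrite k_gt0 leqnn => /(_ isT).
  rewrite /M /beta /pivot_quality /pivot; case: (k) k_gt0 => // k' _ /=.
  exact: ge_step_growth.
have : ln (M k) <= ln (M k.-1) + ln (1 + (beta k)^-1).
  rewrite -lnM ?posrE ?addr_gt0 ?invr_gt0 // ler_ln ?posrE //.
  by rewrite mulr_gt0 ?addr_gt0 ?invr_gt0.
move: prev; rewrite -/(M k.-1) -/(M k); lra.
Qed.

(** * Real matrices and the theorem *)

Section RealEmbedding.
Context (R : realType) (m n : nat).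
Local Notation embed := (map_mx (real_complex R)).
Implicit Types (A : 'M[R]_(m, n)) (pr : nat -> 'I_m) (pc : nat -> 'I_n).

Lemma normc_real (x : R) : Normc.normc (x%:C) = `|x|.
Proof. by rewrite /= expr0n addr0 sqrtr_sqr. Qed.

Lemma max_entry_embed A :
  max_entry (@Normc.normc R) (embed A) = max_entry (fun x : R => `|x|) A.
Proof.
apply: eq_bigr => i _; apply: eq_bigr => j _.
by rewrite mxE normc_real.
Qed.

Lemma ge_iter_embed A pr pc s :
  ge_iter (embed A) pr pc s = embed (ge_iter A pr pc s).
Proof.
elim: s => [|s IH]; first by [].
rewrite /= IH /ge_step map_mxB map_mxZ map_mxM map_col map_row mxE fmorphV.
by [].
Qed.

Lemma pivot_embed A pr pc s :
  pivot (embed A) pr pc s = (pivot A pr pc s)%:C.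
Proof. by rewrite /pivot ge_iter_embed mxE. Qed.

Lemma pivot_quality_embed A pr pc :
  pivot_quality (@Normc.normc R) (embed A) pr pc
  = pivot_quality (fun x : R => `|x|) A pr pc.
Proof.
apply/funext => s.
by rewrite /pivot_quality pivot_embed ge_iter_embed max_entry_embed normc_real.
Qed.
End RealEmbedding.

Theorem theorem3p1 (R : realType) (m n k : nat) (hk : (1 <= k <= minn m n)%N) :
  (forall (A : 'M[R]_(m, n)) (pr : nat -> 'I_m) (pc : nat -> 'I_n),
     A != 0 -> valid_pivots A pr pc k ->
     let beta := pivot_quality (fun x : R => `|x|) A pr pc in
     growth_factor (fun x : R => `|x|) A pr pc k <=
       2 * (beta k + (beta k)^-1)
       * (beta 1%N ^+ 2
          * \prod_(2 <= r < k) (beta r `^ ((k - r)%:R^-1)))^-1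
       * Num.sqrt k%:R * (k%:R `^ (4^-1 * ln k%:R)))
  /\
  (forall (A : 'M[R[i]]_(m, n)) (pr : nat -> 'I_m) (pc : nat -> 'I_n),
     A != 0 -> valid_pivots A pr pc k ->
     let beta := pivot_quality (@ComplexField.Normc.normc R) A pr pc in
     growth_factor (@ComplexField.Normc.normc R) A pr pc k <=
       2 * (beta k + (beta k)^-1)
       * (beta 1%N ^+ 2
          * \prod_(2 <= r < k) (beta r `^ ((k - r)%:R^-1)))^-1
       * Num.sqrt k%:R * (k%:R `^ (4^-1 * ln k%:R))).
Proof.
have /andP[k_gt0 _] := hk; split=> A pr pc _ piv; last first.
  exact: growth_factor_complex.
have pivC : valid_pivots (map_mx (real_complex R) A) pr pc k.
  by move=> s hs; rewrite pivot_embed fmorph_eq0 piv.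
have := growth_factor_complex k_gt0 pivC.
rewrite /growth_factor pivot_quality_embed ge_iter_embed !max_entry_embed.
exact: id.
Qed.
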